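(* Let $k$ be a field with $u(k)\leq 2$ which is not quadratically closed, with $\mathrm{char}(k)\neq 2$ and $|k|\geq 5$. Let $G:=\mathrm{PSL}_2(k)$, and for $x\in\mathrm{SL}_2(k)$ let $\bar x$ denote its image in $G$. Let $\overline{\epsilon_1},\overline{\epsilon_2}\in k^{\times}/k^{\times 2}$ (not necessarily distinct). Let $\mathscr{C}_1$ and $\mathscr{C}_2$ be the unipotent conjugacy classes in $G$ of $\overline{\begin{pmatrix}1 & \epsilon_1\\ 0 & 1\end{pmatrix}}$ and $\overline{\begin{pmatrix}1 & \epsilon_2\\ 0 & 1\end{pmatrix}}$ respectively. Let $\Phi$ be the set of semisimple elements $\bar{x}\in G$ such that at least one of $2-\mathrm{tr}(x)$ or $2+\mathrm{tr}(x)$ is in $\epsilon_1\epsilon_2k^{\times 2}$. Then $$\mathscr{C}_1\mathscr{C}_2=\begin{cases}\{\text{unipotent elements}\}\cup\Phi\cup\{1\} & \text{if } \overline{\epsilon_2}=\overline{-\epsilon_1},\\ \{\text{unipotent elements}\}\cup\Phi & \text{otherwise}.\end{cases}$$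
   Context: A field $k$ has $u(k)\leq 2$ if every quadratic form in $3$ variables over $k$ is isotropic. A field is quadratically closed if it admits no quadratic extension. $k^{\times 2}$ is the set of squares in $k^\times$, and $\bar\epsilon$ denotes the image of $\epsilon\in k^\times$ in $k^\times/k^{\times2}$. Semisimple elements of $\mathrm{PSL}_2(k)=\mathrm{SL}_2(k)/\{\pm I\}$ are the images of non-central semisimple elements of $\mathrm{SL}_2(k)$. Unipotent elements of $\mathrm{PSL}_2(k)$ are the images of non-identity unipotent elements of $\mathrm{SL}_2(k)$; the identity is not counted as unipotent. $\mathscr{C}_1\mathscr{C}_2=\{xy: x\in\mathscr{C}_1,y\in\mathscr{C}_2\}$. *)

(* Defs.v *)
From HB Require Import structures.
From mathcomp Require Import all_boot all_order all_algebra all_field.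
From mathcomp Require Import boolp classical_sets.
Set Implicit Arguments.
Unset Strict Implicit.
Unset Printing Implicit Defensive.

Import GRing.Theory.

Local Open Scope classical_set_scope.
Local Open Scope quotient_scope.
Local Open Scope ring_scope.

(* Every homogeneous quadratic polynomial in [n] variables is the form of some
   matrix [A], which need not be symmetric. *)
Definition quadform (k : fieldType) (n : nat) (A : 'M[k]_n) (v : 'rV[k]_n) : k :=
  \sum_i \sum_j A i j * (v 0 i * v 0 j).

Definition isotropic (k : fieldType) (n : nat) (A : 'M[k]_n) : Prop :=
  exists2 v : 'rV[k]_n, v != 0 & quadform A v = 0.

Definition u_le2 (k : fieldType) : Prop := forall A : 'M[k]_3, isotropic A.

Definition quadratically_closed (k : fieldType) : Prop :=
  ~ exists L : fieldExtType k, \dim {:L} = 2%N.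

(* The coset [e k^{x2}], for [e] in [k^x]; equality of these sets is equality
   in the quotient [k^x / k^{x2}]. *)
Definition sqcoset (k : fieldType) (e : k) : set k :=
  [set e * c ^+ 2 | c in [set c : k | c != 0]].

Section SL2.
Variable k : fieldType.

Record SL2 : Type := MkSL2 { SL2val :> 'M[k]_2; _ : \det SL2val == 1 }.

HB.instance Definition _ := [isSub for SL2val].
HB.instance Definition _ := [Choice of SL2 by <:].

Lemma SL2_det (x : SL2) : \det x = 1.
Proof. exact/eqP/(valP x). Qed.

Fact SL2_one_subproof : \det (1 : 'M[k]_2) == 1.
Proof. by rewrite det1. Qed.
Fact SL2_mul_subproof (x y : SL2) : \det (SL2val x * SL2val y) == 1.
Proof. by rewrite det_mulmx !SL2_det mulr1. Qed.
Fact SL2_inv_subproof (x : SL2) : \det (SL2val x)^-1 == 1.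
Proof. by rewrite det_inv SL2_det invr1. Qed.

Definition SL2_one := MkSL2 SL2_one_subproof.
Definition SL2_mul (x y : SL2) := MkSL2 (SL2_mul_subproof x y).
Definition SL2_inv (x : SL2) := MkSL2 (SL2_inv_subproof x).

Lemma SL2_unit (x : SL2) : SL2val x \is a GRing.unit.
Proof. by rewrite unitmxE SL2_det unitr1. Qed.

Fact SL2_mulA : associative SL2_mul.
Proof. by move=> x y z; apply/val_inj/mulrA. Qed.
Fact SL2_mul1 : left_id SL2_one SL2_mul.
Proof. by move=> x; apply/val_inj/mul1r. Qed.
Fact SL2_mulr1 : right_id SL2_one SL2_mul.
Proof. by move=> x; apply/val_inj/mulr1. Qed.
Fact SL2_mulV : left_inverse SL2_one SL2_inv SL2_mul.
Proof. by move=> x; apply/val_inj/mulVr/SL2_unit. Qed.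
Fact SL2_mulrV : right_inverse SL2_one SL2_inv SL2_mul.
Proof. by move=> x; apply/val_inj/mulrV/SL2_unit. Qed.

HB.instance Definition _ :=
  isGroup.Build SL2 SL2_mulA SL2_mul1 SL2_mulr1 SL2_mulV SL2_mulrV.

Definition SL2_eqpm (x y : SL2) : bool :=
  (SL2val x == SL2val y) || (SL2val x == - SL2val y).

Fact SL2_eqpm_refl : reflexive SL2_eqpm.
Proof. by move=> x; rewrite /SL2_eqpm eqxx. Qed.
Fact SL2_eqpm_sym : symmetric SL2_eqpm.
Proof.
move=> x y; rewrite /SL2_eqpm [SL2val y == _]eq_sym; congr (_ || _).
by rewrite [RHS]eq_sym eqr_oppLR.
Qed.
Fact SL2_eqpm_trans : transitive SL2_eqpm.
Proof.
move=> y x z; rewrite /SL2_eqpm => /orP[]/eqP-> /orP[]/eqP->.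
- by rewrite eqxx.
- by rewrite eqxx orbT.
- by rewrite eqxx orbT.
- by rewrite opprK eqxx.
Qed.

Canonical SL2_eqpm_equiv :=
  EquivRel SL2_eqpm SL2_eqpm_refl SL2_eqpm_sym SL2_eqpm_trans.

Definition PSL2 : Type := {eq_quot SL2_eqpm}.
HB.instance Definition _ := Choice.on PSL2.
HB.instance Definition _ := EqQuotient.on PSL2.

Definition toPSL2 (x : SL2) : PSL2 := \pi_PSL2 x.

Lemma toPSL2_eq (x y : SL2) :
  toPSL2 x = toPSL2 y <-> SL2val x = SL2val y \/ SL2val x = - SL2val y.
Proof.
rewrite /toPSL2; split=> [/eqP|h].
  by rewrite eqmodE /= => /orP[]/eqP->; [left | right].
by apply/eqP; rewrite eqmodE /= /SL2_eqpm; case: h => ->; rewrite eqxx ?orbT.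
Qed.

Lemma toPSL2_repr (g : PSL2) : toPSL2 (repr g) = g.
Proof. exact: reprK. Qed.

Definition PSL2_one : PSL2 := toPSL2 SL2_one.
Definition PSL2_mul (g h : PSL2) : PSL2 := toPSL2 (SL2_mul (repr g) (repr h)).
Definition PSL2_inv (g : PSL2) : PSL2 := toPSL2 (SL2_inv (repr g)).

Fact PSL2_mul_pi (x y : SL2) :
  PSL2_mul (toPSL2 x) (toPSL2 y) = toPSL2 (SL2_mul x y).
Proof.
apply/toPSL2_eq; rewrite /=.
case/toPSL2_eq: (toPSL2_repr (toPSL2 x)) => ->;
case/toPSL2_eq: (toPSL2_repr (toPSL2 y)) => ->;
by rewrite ?mulNr ?mulrN ?opprK; auto.
Qed.

Fact PSL2_inv_pi (x : SL2) : PSL2_inv (toPSL2 x) = toPSL2 (SL2_inv x).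
Proof.
apply/toPSL2_eq; rewrite /=.
by case/toPSL2_eq: (toPSL2_repr (toPSL2 x)) => ->; rewrite ?invrN; auto.
Qed.

Fact PSL2_mulA : associative PSL2_mul.
Proof.
move=> g h l; rewrite -(toPSL2_repr g) -(toPSL2_repr h) -(toPSL2_repr l).
by rewrite !PSL2_mul_pi SL2_mulA.
Qed.
Fact PSL2_mul1 : left_id PSL2_one PSL2_mul.
Proof. by move=> g; rewrite -(toPSL2_repr g) PSL2_mul_pi SL2_mul1. Qed.
Fact PSL2_mulr1 : right_id PSL2_one PSL2_mul.
Proof. by move=> g; rewrite -(toPSL2_repr g) PSL2_mul_pi SL2_mulr1. Qed.
Fact PSL2_mulV : left_inverse PSL2_one PSL2_inv PSL2_mul.
Proof. by move=> g; rewrite -(toPSL2_repr g) PSL2_inv_pi PSL2_mul_pi SL2_mulV. Qed.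
Fact PSL2_mulrV : right_inverse PSL2_one PSL2_inv PSL2_mul.
Proof. by move=> g; rewrite -(toPSL2_repr g) PSL2_inv_pi PSL2_mul_pi SL2_mulrV. Qed.

HB.instance Definition _ :=
  isGroup.Build PSL2 PSL2_mulA PSL2_mul1 PSL2_mulr1 PSL2_mulV PSL2_mulrV.

Lemma toPSL2M (x y : SL2) : toPSL2 (x * y)%g = (toPSL2 x * toPSL2 y)%g.
Proof. by rewrite [RHS]PSL2_mul_pi. Qed.

Definition mx2 (a b c d : k) : 'M[k]_2 :=
  \matrix_(i, j) (if i == 0 then (if j == 0 then a else b)
                  else (if j == 0 then c else d)).

Lemma det_mx2 (a b c d : k) : \det (mx2 a b c d) = a * d - b * c.
Proof.
rewrite (expand_det_row _ 0) !big_ord_recl big_ord0 addr0 /cofactor !det_mx11.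
by rewrite !mxE /= addn0 expr0 expr1 mul1r mulN1r mulrN.
Qed.

Fact upper_unip_subproof (e : k) : \det (mx2 1 e 0 1) == 1.
Proof. by rewrite det_mx2 mulr1 mulr0 subr0. Qed.

Definition upper_unip (e : k) : SL2 := MkSL2 (upper_unip_subproof e).

Definition SL2_central (x : SL2) : Prop := forall y : SL2, commute x y.

(* Semisimplicity is diagonalizability over an algebraic closure of [k]; a
   conjugating matrix only involves finitely many algebraic elements, so this
   amounts to diagonalizability over some extension [L] of [k]. *)
Definition SL2_semisimple (x : SL2) : Prop :=
  exists (L : fieldType) (f : {rmorphism k -> L}),
    diagonalizable (map_mx f (SL2val x)).

Definition SL2_unipotent (x : SL2) : Prop :=
  exists n : nat, (SL2val x - 1) ^+ n = 0.

Definition PSL2_unipotent : set PSL2 :=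
  [set toPSL2 x | x in [set x | SL2_unipotent x /\ x <> 1%g]].

Definition PSL2_semisimple : set PSL2 :=
  [set toPSL2 x | x in [set x | SL2_semisimple x /\ ~ SL2_central x]].

Definition Phi (e1 e2 : k) : set PSL2 :=
  [set toPSL2 x | x in
    [set x : SL2 | PSL2_semisimple (toPSL2 x) /\
      (sqcoset (e1 * e2) (2 - \tr (SL2val x)) \/
       sqcoset (e1 * e2) (2 + \tr (SL2val x)))]].

End SL2.

Arguments PSL2_unipotent k : clear implicits.
Arguments PSL2_semisimple k : clear implicits.

Definition conj_class (G : groupType) (g : G) : set G := range (conjg g).

Definition set_mulg (G : groupType) (A B : set G) : set G :=
  [set (x * y)%g | x in A & y in B].

(* Main.v *)
Require Import Defs.
From HB Require Import structures.
From mathcomp Require Import all_boot all_order all_algebra all_field.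
From mathcomp Require Import boolp classical_sets.
From mathcomp Require Import ring.
Set Implicit Arguments.
Unset Strict Implicit.
Unset Printing Implicit Defensive.

Import GRing.Theory.

Local Open Scope classical_set_scope.
Local Open Scope ring_scope.

(* The conjugates of [u(e)] are the transvections [T(e, v) : w |-> w + e det(v, w) v]
   with [v != 0], and [tr (T(e1, v) T(e2, w)) = 2 - e1 e2 det(v, w)^2].  If [v] and
   [w] are colinear the product is [T(d, v)] with [d] a value of the form
   [<e1, e2>]; otherwise its trace shows that it is in [Phi], or is the opposite of
   a unipotent element.  Conversely, if [2 - tr z = e1 e2 l^2] with [l != 0], then
   [z] is a product as soon as the quadratic form [v |-> det(v, z v)], whose
   discriminant is [(tr z)^2 - 4], represents [- e2 l^2]; since [u(k) <= 2], every
   nondegenerate binary form is universal.  For a unipotent target one also needs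
   [<e1, e2>] to represent [d] by a vector off the axes.  This can only fail (as
   over F_5) when both [e1 e2] and [- d e1] are squares, and then the opposite
   lift [- T(d, v)], of trace [-2], is a product by the same criterion. *)

(** * Values of nondegenerate binary quadratic forms *)

Section BinaryForms.
Variable k : fieldType.

Definition binform (A B C a c : k) : k := A * a ^+ 2 + B * (a * c) + C * c ^+ 2.

(** Let [v0 = (a0, c0)]. The value at [l v0 + e_i] is affine in [l], with slope the [i]-th partial
    derivative at [v0], so it reaches [m] once that slope is nonzero. If both slopes vanished, [v0]
    would lie in the radical, which the discriminant excludes. *)
Lemma isotropic_binform_universal (A B C a0 c0 m : k) :
    B ^+ 2 - 4 * (A * C) != 0 -> (a0 != 0) || (c0 != 0) ->
    binform A B C a0 c0 = 0 -> exists a c, binform A B C a c = m.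
Proof.
rewrite /binform => disc_neq0 v_neq0 Q0.
have [g0|g_neq0] := eqVneq (2 * A * a0 + B * c0) 0; last first.
  pose l := (m - A) / (2 * A * a0 + B * c0).
  exists (l * a0 + 1), (l * c0).
  transitivity (l ^+ 2 * (A * a0 ^+ 2 + B * (a0 * c0) + C * c0 ^+ 2)
                + l * (2 * A * a0 + B * c0) + A); first by ring.
  by rewrite Q0 /l divfK //; ring.
have [h0|h_neq0] := eqVneq (B * a0 + 2 * C * c0) 0; last first.
  pose l := (m - C) / (B * a0 + 2 * C * c0).
  exists (l * a0), (l * c0 + 1).
  transitivity (l ^+ 2 * (A * a0 ^+ 2 + B * (a0 * c0) + C * c0 ^+ 2)
                + l * (B * a0 + 2 * C * c0) + C); first by ring.
  by rewrite Q0 /l divfK //; ring.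
have da0 : (B ^+ 2 - 4 * (A * C)) * a0 = 0.
  transitivity (B * (B * a0 + 2 * C * c0) - 2 * C * (2 * A * a0 + B * c0)).
    by ring.
  by rewrite g0 h0 !mulr0 subr0.
have dc0 : (B ^+ 2 - 4 * (A * C)) * c0 = 0.
  transitivity (B * (2 * A * a0 + B * c0) - 2 * A * (B * a0 + 2 * C * c0)).
    by ring.
  by rewrite g0 h0 !mulr0 subr0.
move/eqP: da0; move/eqP: dc0; rewrite !mulf_eq0 (negPf disc_neq0) /=.
by move=> c00 a00; rewrite a00 c00 in v_neq0.
Qed.

Hypothesis uk : u_le2 k.

(** The ternary form [Q(a, c) - m w^2] has a nontrivial zero. If [w != 0], divide by [w]; if
    [w = 0], then [Q] itself is isotropic. *)
Lemma u_le2_binform_universal (A B C m : k) :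
  B ^+ 2 - 4 * (A * C) != 0 -> exists a c, binform A B C a c = m.
Proof.
move=> disc_neq0.
pose M : 'M[k]_3 := \matrix_(i, j)
  nth 0 (nth [::] [:: [:: A; B; 0]; [:: 0; C; 0]; [:: 0; 0; - m]] i) j.
have [v v_neq0] := uk M.
rewrite /quadform !big_ord_recl !big_ord0 !mxE /=.
set a := v 0 ord0; set c := v 0 (lift _ _); set w := v 0 (lift _ _) => Q0.
have Qw : binform A B C a c = m * w ^+ 2.
  by apply/eqP; rewrite -subr_eq0 /binform -Q0; apply/eqP; ring.
have [w0|w_neq0] := eqVneq w 0; last first.
  exists (a / w), (c / w); apply: (mulIf (expf_neq0 2 w_neq0)); rewrite -Qw.
  by rewrite /binform; field.
apply: (@isotropic_binform_universal _ _ _ a c) => //; last first.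
  by rewrite Qw w0 expr0n mulr0.
apply: contraNT v_neq0; rewrite negb_or !negbK => /andP[/eqP a0 /eqP c0].
apply/eqP/rowP => i; rewrite mxE.
case: (unliftP ord0 i) => [i' ->|-> //].
case: (unliftP ord0 i') => [i'' ->|-> //].
by rewrite (ord1 i'').
Qed.

Hypothesis card_ge5 : exists2 s : seq k, uniq s & (5 <= size s)%N.

(** At the values [1] and [-1] the parametrization in [conic_point] gives [s = 0] or has a pole.
    Five elements suffice to avoid one value with [m != 0], since [X (f X^2 - e)] has at most three
    roots, but not both: over F_5 with [f = 1] every nonzero [m] hits one. If one value is never
    attained, avoiding the other is enough. *)
Lemma sq_avoid_pm1 (f : k) : f != 0 ->
    (exists m, [/\ m != 0, f * m ^+ 2 != 1 & f * m ^+ 2 != -1]) \/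
    ((exists m, f * m ^+ 2 = 1) /\ (exists m, f * m ^+ 2 = -1)).
Proof.
move=> f_neq0.
have avoid (e : k) : exists2 m, m != 0 & f * m ^+ 2 != e.
  case: card_ge5 => s s_uniq s_size.
  pose p : {poly k} := 'X * (f *: 'X^2 - e%:P).
  have [m _ ] : exists2 m, m \in s & ~~ root p m.
    apply/allPn; apply: contraL s_size => s_root; rewrite -ltnNge ltnS.
    have szq : size (f *: 'X^2 - e%:P) = 3%N.
      have szX : size (f *: 'X^2) = 3%N by rewrite size_scale // size_polyXn.
      by rewrite size_polyDl szX // size_polyN size_polyC; case: (e != 0).
    have q_neq0 : f *: 'X^2 - e%:P != 0 by rewrite -size_poly_gt0 szq.
    have p_neq0 : p != 0 by rewrite mulf_neq0 ?polyX_eq0.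
    have := max_poly_roots p_neq0 s_root s_uniq.
    by rewrite size_mul ?polyX_eq0 // size_polyX szq => /ltnW.
  rewrite rootE !hornerE mulf_eq0 negb_or subr_eq0 => /andP[m_neq0 fm].
  by exists m => //; rewrite expr2 mulrA.
have [hit|/forallNP miss] := pselect (exists m, f * m ^+ 2 = -1); last first.
  have [m m_neq0 fm] := avoid 1; left; exists m; split=> //.
  exact/eqP/miss.
have [hit1|/forallNP miss1] := pselect (exists m, f * m ^+ 2 = 1).
  by right.
have [m m_neq0 fm] := avoid (-1); left; exists m; split=> //.
exact/eqP/miss1.
Qed.

Hypothesis two_neq0 : 2 != 0 :> k.

(* The witness comes from parametrizing the conic by the lines through [(1, 0)]. *)
Lemma conic_point (f : k) : f != 0 ->
    (exists s a, [/\ s != 0, a != 0 & s ^+ 2 + f * a ^+ 2 = 1]) \/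
    ((exists m, f * m ^+ 2 = 1) /\ (exists m, f * m ^+ 2 = -1)).
Proof.
move=> f_neq0; case: (sq_avoid_pm1 f_neq0) => [[m [m_neq0 fm1 fmN1]]|]; last first.
  by right.
have den_neq0 : 1 + f * m ^+ 2 != 0 by rewrite addrC addr_eq0.
left; exists ((1 - f * m ^+ 2) / (1 + f * m ^+ 2)), (2 * m / (1 + f * m ^+ 2)).
split; last by field.
- by rewrite mulf_neq0 ?invr_neq0 // subr_eq0 eq_sym.
- by rewrite !mulf_neq0 ?invr_neq0.
Qed.

(** Universality represents [d]; a representing vector on an axis is moved off it by a point of the
    conic [s^2 + f a^2 = 1]. In the second alternative, [4] is [2 - tr] for an element of trace
    [-2]. *)
Lemma diag_binform_repr (e1 e2 d : k) : e1 != 0 -> e2 != 0 -> d != 0 ->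
    (exists s a, [/\ s != 0, a != 0 & e1 * s ^+ 2 + e2 * a ^+ 2 = d]) \/
    (exists x r, [/\ x != 0, r != 0, e1 * e2 * x ^+ 2 = 4 & - d * e1 = r ^+ 2]).
Proof.
move=> e1_neq0 e2_neq0 d_neq0.
have mN1_neq0 (f m : k) : f * m ^+ 2 = -1 -> m != 0.
  move=> fm; apply/eqP => m0; move/eqP: fm.
  by rewrite m0 expr0n mulr0 eq_sym oppr_eq0 oner_eq0.
have m1_neq0 (f m : k) : f * m ^+ 2 = 1 -> m != 0.
  move=> fm; apply/eqP => m0; move/eqP: fm.
  by rewrite m0 expr0n mulr0 eq_sym oner_eq0.
have [s [a]] : exists s a, binform e1 0 e2 s a = d.
  apply: u_le2_binform_universal; rewrite expr0n sub0r oppr_eq0.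
  by rewrite !mulf_neq0 // -[4]/((2 * 2)%:R) natrM mulf_neq0.
rewrite /binform mul0r addr0 => dE.
have [a0|a_neq0] := eqVneq a 0; last have [s0|s_neq0] := eqVneq s 0.
- have s_neq0 : s != 0.
    by apply: contra_neq d_neq0 => s0; rewrite -dE a0 s0 !expr0n !mulr0 addr0.
  have f_neq0 : e2 / e1 != 0 by rewrite mulf_neq0 ?invr_neq0.
  case: (conic_point f_neq0) => [[x [y [x_neq0 y_neq0 xy]]]|[[m fm] [n fn]]].
    left; exists (s * x), (s * y); split; rewrite ?mulf_neq0 //.
    transitivity (e1 * s ^+ 2 * (x ^+ 2 + e2 / e1 * y ^+ 2)); first by field.
    by rewrite xy -dE a0 expr0n mulr0 addr0 mulr1.
  (* [f m^2 = 1] puts [e1] and [e2] in one square class, so [e1 * e2] is a square. Together with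
     [f n^2 = -1] this makes [-1] a square, hence also [- d * e1 = - (s * e1)^2]. *)
  right; have m_neq0 := m1_neq0 _ _ fm; have n_neq0 := mN1_neq0 _ _ fn.
  have e1E : e1 = e2 * m ^+ 2 by rewrite -[LHS]mulr1 -fm; field.
  exists (2 / (e2 * m)), (s * e2 * m * n); split.
  + by rewrite !mulf_neq0 ?invr_neq0 ?mulf_neq0.
  + by rewrite !mulf_neq0.
  + by rewrite e1E; field; rewrite m_neq0.
  + rewrite -dE a0 expr0n mulr0 addr0.
    transitivity (-1 * (s * e1) ^+ 2); first by ring.
    transitivity (e2 * e1 * (s * n) ^+ 2); first by rewrite -fn; field.
    by rewrite e1E; ring.
- have f_neq0 : e1 / e2 != 0 by rewrite mulf_neq0 ?invr_neq0.
  case: (conic_point f_neq0) => [[x [y [x_neq0 y_neq0 xy]]]|[[m fm] [n fn]]].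
    left; exists (a * y), (a * x); split; rewrite ?mulf_neq0 //.
    transitivity (e2 * a ^+ 2 * (x ^+ 2 + e1 / e2 * y ^+ 2)); first by field.
    by rewrite xy -dE s0 expr0n mulr0 add0r mulr1.
  right; have m_neq0 := m1_neq0 _ _ fm; have n_neq0 := mN1_neq0 _ _ fn.
  have e2E : e2 = e1 * m ^+ 2 by rewrite -[LHS]mulr1 -fm; field.
  have e2E' : - e2 = e1 * n ^+ 2 by rewrite -[LHS]mulr1 mulNr -mulrN -fn; field.
  exists (2 / (e1 * m)), (e1 * a * n); split.
  + by rewrite !mulf_neq0 ?invr_neq0 ?mulf_neq0.
  + by rewrite !mulf_neq0.
  + by rewrite e2E; field; rewrite m_neq0.
  + rewrite -dE s0 expr0n mulr0 add0r.
    transitivity (- e2 * e1 * a ^+ 2); first by ring.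
    by rewrite e2E'; ring.
- by left; exists s, a.
Qed.

End BinaryForms.

(** * Transvections and unipotent conjugacy classes *)

Section SL2Theory.
Variable k : fieldType.
Implicit Types (x y z : SL2 k) (g : PSL2 k).

Lemma mx2_eta (M : 'M[k]_2) : M = mx2 (M 0 0) (M 0 1) (M 1 0) (M 1 1).
Proof.
apply/matrixP => i j; rewrite !mxE.
by case: i => [[|[|//]] ?]; case: j => [[|[|//]] ?] /=; congr (M _ _);
   apply: val_inj.
Qed.

Lemma mx2_inj (a b c d a' b' c' d' : k) : mx2 a b c d = mx2 a' b' c' d' ->
  [/\ a = a', b = b', c = c' & d = d'].
Proof.
move=> /matrixP eqM.
by move: (eqM 0 0) (eqM 0 1) (eqM 1 0) (eqM 1 1); rewrite !mxE.
Qed.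

Lemma mul_mx2 (a b c d a' b' c' d' : k) :
  mx2 a b c d * mx2 a' b' c' d' =
  mx2 (a * a' + b * c') (a * b' + b * d') (c * a' + d * c') (c * b' + d * d').
Proof.
by rewrite [LHS]mx2_eta !mxE !big_ord_recl !big_ord0 !mxE /= !addr0.
Qed.

Lemma opp_mx2 (a b c d : k) : - mx2 a b c d = mx2 (- a) (- b) (- c) (- d).
Proof. by rewrite [LHS]mx2_eta !mxE. Qed.

Lemma scalar_mx2 (a : k) : a%:M = mx2 a 0 0 a.
Proof. by rewrite [LHS]mx2_eta !mxE. Qed.

Lemma trace_mx2 (a b c d : k) : \tr (mx2 a b c d) = a + d.
Proof. by rewrite /mxtrace !big_ord_recl big_ord0 !mxE /= addr0. Qed.

Lemma SL2_mx2P x :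
  exists p q r s, SL2val x = mx2 p q r s /\ p * s = 1 + q * r.
Proof.
exists (SL2val x 0 0), (SL2val x 0 1), (SL2val x 1 0), (SL2val x 1 1).
split; first exact: mx2_eta.
by have := SL2_det x; rewrite {1}[SL2val x]mx2_eta det_mx2 => <-; rewrite subrK.
Qed.

Fact SL2_opp_subproof x : \det (- SL2val x) == 1.
Proof. by rewrite -scaleN1r detZ SL2_det sqrrN expr1n mulr1. Qed.

Definition SL2_opp x : SL2 k := MkSL2 (SL2_opp_subproof x).

Lemma toPSL2N x : toPSL2 (SL2_opp x) = toPSL2 x.
Proof. by apply/toPSL2_eq; right. Qed.

Fact transv_subproof (e a c : k) :
  \det (mx2 (1 - e * (a * c)) (e * a ^+ 2) (- (e * c ^+ 2)) (1 + e * (a * c)))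
  == 1.
Proof. by apply/eqP; rewrite det_mx2; ring. Qed.

(* With [v = (a, c)^T], the map [w |-> w + e * det (v, w) * v]; it is the
   conjugate of [upper_unip e] by any matrix of [SL2] with first column [v]. *)
Definition transv (e a c : k) : SL2 k := MkSL2 (transv_subproof e a c).

Lemma transvZ (e l a c : k) : transv (e * l ^+ 2) a c = transv e (l * a) (l * c).
Proof. by apply: val_inj; rewrite /=; congr mx2; ring. Qed.

Lemma transvM (e e' a c : k) :
  (transv e a c * transv e' a c)%g = transv (e + e') a c.
Proof. by apply: val_inj; rewrite /= mul_mx2; congr mx2; ring. Qed.

Lemma transv0 (a c : k) : transv 0 a c = 1%g.
Proof.
by apply: val_inj; rewrite /= [RHS]scalar_mx2; congr mx2; ring.
Qed.

Lemma transvV (e a c : k) : (transv e a c * transv (- e) a c)%g = 1%g.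
Proof. by rewrite transvM subrr transv0. Qed.

Lemma trace_transvM (e e' a c a' c' : k) :
  \tr (SL2val (transv e a c * transv e' a' c')%g) =
    2 - e * e' * (a * c' - a' * c) ^+ 2.
Proof. by rewrite /= mul_mx2 trace_mx2; ring. Qed.

Lemma trace_transv (e a c : k) : \tr (SL2val (transv e a c)) = 2.
Proof. by rewrite trace_mx2; ring. Qed.

Lemma transv_neq1 (e a c : k) : e != 0 -> (a != 0) || (c != 0) ->
  transv e a c <> 1%g.
Proof.
move=> e_neq0 v_neq0 /(congr1 (@SL2val k)); rewrite /= [RHS]scalar_mx2.
case/mx2_inj => _ /eqP + /eqP + _.
rewrite oppr_eq0 !mulf_eq0 (negPf e_neq0) /= !orbb.
by move=> a0 c0; rewrite a0 c0 in v_neq0.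
Qed.

(** By Cayley-Hamilton [x - 1] has square zero, so it is a rank one map [w |-> e det(v, w) v]. The
    vector [v] spans its image, and [e] is read off an off-diagonal entry. *)
Lemma trace2_transv x : \tr (SL2val x) = 2 -> x <> 1%g ->
  exists e a c, [/\ e != 0, (a != 0) || (c != 0) & x = transv e a c].
Proof.
have [p [q [r [s [xE detx]]]]] := SL2_mx2P x.
rewrite xE trace_mx2 => trx x_neq1.
have {}sE : s = 2 - p by rewrite -trx; ring.
have qr : q * r = - (1 - p) ^+ 2.
  by rewrite -[LHS](addKr 1) -detx sE; ring.
have [q0|q_neq0] := eqVneq q 0; last first.
  exists q, 1, ((1 - p) / q); split; rewrite ?oner_eq0 //.
  apply: val_inj; rewrite /= xE sE; congr mx2.
  - by field.
  - by ring.
  - apply: (mulfI q_neq0); rewrite qr; field; exact: q_neq0.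
  - by field.
have pE : p = 1.
  apply/eqP; rewrite eq_sym -subr_eq0 -sqrf_eq0 -oppr_eq0 -qr q0 mul0r //.
exists (- r), 0, 1; split; rewrite ?oner_eq0 ?orbT //.
  rewrite oppr_eq0; apply/eqP => r0; apply: x_neq1; apply: val_inj.
  by rewrite /= xE [RHS]scalar_mx2 sE pE q0 r0; congr mx2; ring.
by apply: val_inj; rewrite /= xE sE pE q0; congr mx2; ring.
Qed.

(** As [conjg] multiplies by the inverse on the left, the vector is the first column [(s, - r)] of
    [x^-1]. *)
Lemma toPSL2_upper_unipJ (e : k) x (p q r s : k) : SL2val x = mx2 p q r s ->
  (toPSL2 (upper_unip e) ^ toPSL2 x)%g = toPSL2 (transv e s (- r)).
Proof.
move=> xE.
have detx : p * s = 1 + q * r.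
  by have := SL2_det x; rewrite xE det_mx2 => <-; rewrite subrK.
have uxE : (upper_unip e * x = x * transv e s (- r))%g.
  by apply: val_inj; rewrite /= xE !mul_mx2; congr mx2; ring: detx.
move/(congr1 (@toPSL2 k)): uxE; rewrite !toPSL2M => uxE.
by rewrite conjgE uxE mulgA mulVg mul1g.
Qed.

Lemma conj_class_unipP (e : k) g :
  conj_class (toPSL2 (upper_unip e)) g <->
  exists a c, (a != 0) || (c != 0) /\ g = toPSL2 (transv e a c).
Proof.
split=> [[h _ <-]|[a [c [v_neq0 ->]]]].
  rewrite -(toPSL2_repr h); have [p [q [r [s [hE deth]]]]] := SL2_mx2P (repr h).
  exists s, (- r); split; last exact: toPSL2_upper_unipJ hE.
  apply/norP => -[/negPn/eqP s0 ]; rewrite negbK oppr_eq0 => /eqP r0.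
  by move/eqP: deth; rewrite s0 r0 !mulr0 addr0 eq_sym oner_eq0.
(* A bottom row [(- c, a)] makes [(a, c)] the first column of the inverse; the top row only
   completes the determinant to [1]. *)
pose M := if a != 0 then mx2 a^-1 0 (- c) a else mx2 0 c^-1 (- c) a.
have detM : \det M == 1.
  rewrite /M; case: eqVneq v_neq0 => [-> /= c_neq0|a_neq0 _]; rewrite det_mx2.
    by rewrite mulrN opprK mul0r add0r mulVf.
  by rewrite mul0r subr0 mulVf.
exists (toPSL2 (MkSL2 detM)) => //.
suff [p [q ME]] : exists p q, M = mx2 p q (- c) a.
  by rewrite (toPSL2_upper_unipJ _ (ME : SL2val (MkSL2 detM) = _)) opprK.
by rewrite /M; case: ifP => _; [exists a^-1, 0 | exists 0, c^-1].
Qed.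

(** * Semisimple and unipotent elements in terms of the trace *)

Lemma quadratic_splits (t : k) : exists (L : fieldType) (f : {rmorphism k -> L}),
  exists l, l ^+ 2 - f t * l + 1 = 0.
Proof.
have [[l lP]|/forallNP no_root] := pselect (exists l, l ^+ 2 - t * l + 1 = 0).
  by exists k, idfun, l.
(* This is the characteristic polynomial of an element of trace [t]; having degree 2 and no root, it
   is irreducible, and a root can be adjoined. *)
pose p : {poly k} := 'X^2 - t *: 'X + 1.
have szp : size p = 3%N.
  have szr : (size (- (t *: 'X) + 1 : {poly k})%R < 3)%N.
    rewrite (leq_ltn_trans (size_polyD _ _)) // size_polyN size_poly1 gtn_max.
    by rewrite (leq_ltn_trans (size_scale_leq _ _)) // size_polyX.
  by rewrite /p -addrA size_polyDl size_polyXn.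
have irrp : irreducible_poly p.
  apply: cubic_irreducible; rewrite ?szp // => l.
  by apply/negP; rewrite rootE !hornerE => /eqP; apply: no_root.
have [L _ [l rootl _]] := irredp_FAdjoin irrp.
exists L, (GRing.in_alg L), l.
move: rootl; rewrite rootE /p rmorphD rmorphB /= map_polyZ map_polyXn map_polyX.
by rewrite rmorph1 !hornerE => /eqP.
Qed.

Lemma diagonalizable_sqr0 (L : fieldType) (A : 'M[L]_2) (e : L) :
  diagonalizable A -> (A - e%:M) ^+ 2 = 0 -> A = e%:M.
Proof.
case=> P P_unit /similar_diagPex[D /simmxPp PA] N2.
have {}PA : P *m A = diag_mx D *m P by apply: PA; rewrite stablemx_unit.
have PN : P *m (A - e%:M) = (diag_mx D - e%:M) *m P.
  by rewrite mulmxBr mulmxBl PA scalar_mxC.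
have DN : (diag_mx D - e%:M) ^+ 2 = 0.
  apply: (can_inj (mulmxK P_unit)); rewrite mul0mx expr2 -mulmxA -PN mulmxA -PN.
  by rewrite -mulmxA -[_ *m (A - _)]/(_ * _) -expr2 N2 mulmx0.
have De : diag_mx D = e%:M.
  move: DN.
  rewrite -diag_const_mx -raddfB /= expr2 -[_ * _]/(_ *m _) mulmx_diag => DN.
  congr diag_mx; apply/rowP => j; rewrite mxE.
  have /matrixP/(_ j j) := DN; rewrite !mxE eqxx mulr1n => /eqP.
  by rewrite mulf_eq0 orbb subr_eq0 => /eqP.
apply: (can_inj (mulKmx P_unit)); rewrite PA De scalar_mxC //.
Qed.

(** If the trace is [2 e] with [e^2 = 1], then [(x - e)^2 = 0], so a diagonalizable [x] is the
    scalar [e], hence central. Otherwise the eigenvalues [l] and [tr x - l] are distinct: their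
    product is [1], so equality would give [l = 1] or [l = -1]. *)
Lemma SL2_semisimple_noncentralP x :
  SL2_semisimple x /\ ~ SL2_central x <->
  \tr (SL2val x) <> 2 /\ \tr (SL2val x) <> -2.
Proof.
have [p [q [r [s [xE detx]]]]] := SL2_mx2P x.
split=> [[[L [f diagx]] ncx]|].
  have scalar_central (e : k) : SL2val x <> e%:M.
    move=> xe; apply: ncx => y; apply: val_inj.
    by rewrite /= xe; exact: (esym (scalar_mxC _ _)).
  have no_sqr0 (e : k) : (SL2val x - e%:M) ^+ 2 <> 0.
    move=> N2; apply: (scalar_central e); apply: (@map_mx_inj _ _ f).
    rewrite map_scalar_mx; apply: (diagonalizable_sqr0 diagx).
    by rewrite -map_scalar_mx -map_mxB -rmorphXn N2 rmorph0.
  have trxN2 (e : k) : e ^+ 2 = 1 -> \tr (SL2val x) <> 2 * e.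
    move=> e2; rewrite xE trace_mx2 => trx; apply: (no_sqr0 e).
    have sE : s = 2 * e - p by rewrite -trx; ring.
    have qrE : q * r = - (e - p) ^+ 2.
      transitivity (p * s - e ^+ 2); last by rewrite sE; ring.
      by rewrite detx e2; ring.
    rewrite xE scalar_mx2 opp_mx2 sE expr2 [mx2 _ _ _ _ + _]mx2_eta !mxE /= mul_mx2.
    rewrite -[RHS](scale0r 1) [RHS]mx2_eta !mxE !mul0r; congr mx2; ring: qrE.
  split; first by rewrite -[2]mulr1; apply: trxN2; rewrite expr1n.
  by rewrite -[-2]mulrN1; apply: trxN2; rewrite sqrrN expr1n.
rewrite xE trace_mx2 => -[tr2 trN2]; split; last first.
  move=> cx.
  (* Commuting with the upper and the lower elementary matrix forces [x] to be scalar, and the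
     determinant then makes it [1] or [-1]. *)
  have /(congr1 (@SL2val k)) := cx (upper_unip 1).
  have /(congr1 (@SL2val k)) := cx (transv (-1) 0 1).
  rewrite /= xE !mul_mx2 => /mx2_inj[+ _ _ _] /mx2_inj[+ + _ _].
  rewrite !(mulr0, mul0r, mulr1, mul1r, expr0n, expr1n, mulN1r, opprK,
            subr0, addr0, add0r) /=.
  rewrite oppr0 mul0r addr0 => pq pr qs.
  have q0 : q = 0 by apply: (addrI p); rewrite pq addr0.
  have r0 : r = 0 by apply: (addrI p); rewrite -pr addr0.
  move: qs detx tr2 trN2; rewrite q0 r0 addr0 add0r mulr0 addr0 => <-.
  rewrite -expr2 => /eqP; rewrite sqrf_eq1 => /orP[]/eqP-> tr2 trN2.
    exact: tr2.
  by apply: trN2; rewrite opprD.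
have [L [f [l lP]]] := quadratic_splits (p + s).
exists L, f; apply/diagonalizableP.
exists [:: l; f (p + s) - l].
  rewrite /= andbT inE; apply/eqP => lE.
  have fl : f (p + s) = 2 * l by rewrite -(subrK l (f _)) -lE; ring.
  have : l ^+ 2 = 1.
    by apply/eqP; rewrite -subr_eq0 -oppr_eq0 -lP fl; apply/eqP; ring.
  move=> /eqP; rewrite sqrf_eq1 => /orP[]/eqP l1.
    by apply: tr2; apply: (fmorph_inj f); rewrite fl l1 mulr1 rmorph_nat.
  by apply: trN2; apply: (fmorph_inj f); rewrite fl l1 mulrN1 rmorphN rmorph_nat.
(* The product of the two linear factors is the characteristic polynomial; that it annihilates [x]
   is checked entrywise. *)
apply/mxminpoly_minP; rewrite !big_cons big_nil mulr1 rmorphM !rmorphB /=.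
rewrite horner_mx_X !horner_mx_C xE.
have fdet : f p * f s = 1 + f q * f r by rewrite -!rmorphM detx rmorphD rmorph1.
rewrite -[RHS](scale0r 1); move: lP; rewrite rmorphD => lP.
have ll : l ^+ 2 = (f p + f s) * l - 1.
  by apply/eqP; rewrite -subr_eq0 -lP; apply/eqP; ring.
apply/matrixP => i j; rewrite !mxE !big_ord_recl big_ord0 !mxE /= addr0.
case: i => [[|[|//]] ?]; case: j => [[|[|//]] ?]; rewrite /= ?mulr1n ?mulr0n.
all: by ring: fdet ll.
Qed.

(** The two lifts have opposite traces and the condition is symmetric in sign, so it may be tested
    on any lift. *)
Lemma PSL2_semisimpleP x :
  PSL2_semisimple k (toPSL2 x) <-> \tr (SL2val x) <> 2 /\ \tr (SL2val x) <> -2.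
Proof.
split=> [[y /SL2_semisimple_noncentralP[try2 tryN2] /toPSL2_eq]|trx].
  case=> [<-//|xE]; rewrite -[SL2val x]opprK -xE raddfN /=.
  split=> E; [apply: tryN2 | apply: try2].
    by rewrite -E opprK.
  exact: oppr_inj.
by exists x => //; apply/SL2_semisimple_noncentralP.
Qed.

(** Passing to the lift [- x] exchanges [2 - tr x] and [2 + tr x], so one alternative suffices. *)
Lemma PhiP (e1 e2 : k) g : Phi e1 e2 g <->
  exists x l, [/\ g = toPSL2 x, l != 0, \tr (SL2val x) <> 2,
    \tr (SL2val x) <> -2 & 2 - \tr (SL2val x) = e1 * e2 * l ^+ 2].
Proof.
split=> [[x [/PSL2_semisimpleP[tr2 trN2] coset] <-]|[x [l [-> l_neq0 tr2 trN2 xE]]]].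
  case: coset => -[l /= l_neq0 xE]; first by exists x, l.
  exists (SL2_opp x), l; rewrite toPSL2N /= raddfN /= opprK.
  split=> // E; [apply: trN2 | apply: tr2]; last exact: oppr_inj.
  by rewrite -E opprK.
by exists x => //; split; [apply/PSL2_semisimpleP | left; exists l].
Qed.

(** A nilpotent [x - 1] is singular, and [det (x - 1) = 2 - tr x] when [det x = 1]. *)
Lemma SL2_unipotent_trace x : SL2_unipotent x -> \tr (SL2val x) = 2.
Proof.
case=> n xn; have [p [q [r [s [xE detx]]]]] := SL2_mx2P x.
have : ~~ (SL2val x - 1 \is a GRing.unit).
  apply/negP => /(unitrX n); rewrite xn unitr0 //.
rewrite unitmxE unitfE negbK -[1]/(1%:M) xE scalar_mx2 opp_mx2.
rewrite [mx2 _ _ _ _ + _]mx2_eta !mxE /= det_mx2 trace_mx2 subr_eq0 => /eqP d0.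
transitivity (p * s - q * r + 1 - ((p - 1) * (s - 1) - (q - 0) * (r - 0))).
  by ring.
by rewrite d0 detx; ring.
Qed.

Lemma PSL2_unipotentP g : PSL2_unipotent k g <->
  exists e a c, [/\ e != 0, (a != 0) || (c != 0) & g = toPSL2 (transv e a c)].
Proof.
split=> [[x [/SL2_unipotent_trace trx x_neq1] <-]|[e [a [c [e_neq0 v_neq0 ->]]]]].
  have [e [a [c [e_neq0 v_neq0 ->]]]] := trace2_transv trx x_neq1.
  by exists e, a, c.
exists (transv e a c) => //; split; last exact: transv_neq1.
exists 2%N; rewrite expr2 -[1]/(1%:M) scalar_mx2 opp_mx2 /=.
rewrite [mx2 _ _ _ _ + _]mx2_eta !mxE /= mul_mx2.
by rewrite -[RHS](scale0r 1) [RHS]mx2_eta !mxE !mul0r; congr mx2; ring.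
Qed.

(** * Products of two unipotent classes *)

Definition unip_class_mul (e1 e2 : k) : set (PSL2 k) :=
  set_mulg (conj_class (toPSL2 (upper_unip e1)))
           (conj_class (toPSL2 (upper_unip e2))).

Lemma unip_class_mulP (e1 e2 : k) g : unip_class_mul e1 e2 g <->
  exists a c a' c', [/\ (a != 0) || (c != 0), (a' != 0) || (c' != 0) &
    g = toPSL2 (transv e1 a c * transv e2 a' c')%g].
Proof.
split=> [[x /conj_class_unipP[a [c [v_neq0 ->]]]]|].
  move=> [y /conj_class_unipP[a' [c' [w_neq0 ->]]] <-].
  by exists a, c, a', c'; split=> //; rewrite toPSL2M.
move=> [a [c [a' [c' [v_neq0 w_neq0 ->]]]]].
exists (toPSL2 (transv e1 a c)); first by apply/conj_class_unipP; exists a, c.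
exists (toPSL2 (transv e2 a' c')); last by rewrite toPSL2M.
by apply/conj_class_unipP; exists a', c'.
Qed.

(* The equation on [(a, c)] says that [transv (- e1) a c * z] has trace [2],
   so that [z] is [transv e1 a c] times a unipotent element; comparing traces,
   the latter has the class of [e2]. *)
Lemma unip_class_mul_criterion (e1 e2 l : k) z (p q r s a c : k) :
    e1 != 0 -> e2 != 0 -> l != 0 -> SL2val z = mx2 p q r s ->
    2 - (p + s) = e1 * e2 * l ^+ 2 ->
    binform (- r) (p - s) q a c = e2 * l ^+ 2 ->
  unip_class_mul e1 e2 (toPSL2 z).
Proof.
move=> e1_neq0 e2_neq0 l_neq0 zE trz Qv.
have trz_neq2 : 2 - (p + s) != 0 by rewrite trz !mulf_neq0 // expf_neq0.
have v_neq0 : (a != 0) || (c != 0).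
  apply: contraNT trz_neq2; rewrite negb_or !negbK => /andP[/eqP a0 /eqP c0].
  by rewrite trz -mulrA -Qv /binform a0 c0; apply/eqP; ring.
have zM : z = (transv e1 a c * (transv (- e1) a c * z))%g.
  by rewrite mulgA transvV mul1g.
have [] := @trace2_transv (transv (- e1) a c * z)%g.
- rewrite /= zE mul_mx2 trace_mx2.
  (* With [v = (a, c)], this [binform] is [- det(v, z v)]: left multiplication by
     [transv (- e1) a c] adds [e1] times it to the trace. *)
  transitivity (p + s + e1 * binform (- r) (p - s) q a c).
    by rewrite /binform; ring.
  by rewrite Qv mulrA -trz; ring.
- move=> y1; move: trz_neq2; rewrite -(trace_mx2 p q r s) -zE zM y1 mulg1.
  by rewrite trace_transv subrr eqxx.
move=> e [a' [c' [e_neq0 w_neq0 yE]]].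
pose d := a * c' - a' * c.
have ed : e * d ^+ 2 = e2 * l ^+ 2.
  apply: (mulfI e1_neq0); rewrite [RHS]mulrA -trz -(trace_mx2 p q r s) -zE zM yE.
  by rewrite trace_transvM /d; ring.
have d_neq0 : d != 0.
  apply: contra_neq l_neq0 => d0; move/esym/eqP: ed.
  by rewrite d0 expr0n mulr0 mulf_eq0 (negPf e2_neq0) sqrf_eq0 => /eqP.
have eE : e = e2 * (l / d) ^+ 2.
  apply: (mulIf (expf_neq0 2 d_neq0)); rewrite ed; field; exact: d_neq0.
(* The square factor between [e] and [e2] is absorbed by rescaling the second vector. *)
apply/unip_class_mulP; exists a, c, (l / d * a'), (l / d * c'); split=> //.
  by rewrite !mulf_eq0 invr_eq0 (negPf l_neq0) (negPf d_neq0).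
by rewrite {1}zM yE eE transvZ.
Qed.

Lemma sqcosetP (e e' : k) : e != 0 -> e' != 0 ->
  sqcoset e = sqcoset e' <-> exists2 l, l != 0 & e = e' * l ^+ 2.
Proof.
move=> e_neq0 e'_neq0; split=> [eq_coset|[l l_neq0 ->]].
  have : sqcoset e e by exists 1; rewrite /= ?oner_eq0 // expr1n mulr1.
  by rewrite eq_coset => -[l l_neq0 <-]; exists l.
apply/seteqP; split=> _ [c /= c_neq0 <-].
  by exists (l * c); rewrite /= ?mulf_neq0 //; ring.
by exists (c / l); rewrite /= ?mulf_neq0 ?invr_neq0 //; field.
Qed.

Lemma colinear2 (a c a' c' : k) : (a != 0) || (c != 0) -> (a' != 0) || (c' != 0) ->
  a * c' - a' * c = 0 -> exists l, [/\ l != 0, a' = l * a & c' = l * c].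
Proof.
move=> v_neq0 w_neq0 /eqP; rewrite subr_eq0 => /eqP d0.
suff [l a'E c'E] : exists2 l, a' = l * a & c' = l * c.
  exists l; split=> //; apply: contraTneq w_neq0 => l0.
  by rewrite a'E c'E l0 !mul0r eqxx.
have [a0|a_neq0] := eqVneq a 0; last first.
  by exists (a' / a); [field | rewrite mulrAC -d0; field].
rewrite a0 eqxx /= in v_neq0; exists (c' / c); last by field.
rewrite a0 mul0r in d0; rewrite a0 mulr0; apply/eqP.
by rewrite -(mulIr_eq0 _ (mulIf v_neq0)) -d0.
Qed.

(** * The inclusions in both directions *)

Hypothesis two_neq0 : 2 != 0 :> k.

Lemma unip_class_mul_sub (e1 e2 : k) g : e1 != 0 -> e2 != 0 ->
    unip_class_mul e1 e2 g ->
  [\/ PSL2_unipotent k g, Phi e1 e2 g | g = 1%g /\ sqcoset e2 = sqcoset (- e1)].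
Proof.
move=> e1_neq0 e2_neq0 /unip_class_mulP[a [c [a' [c' [v_neq0 w_neq0 ->]]]]].
have [d0|d_neq0] := eqVneq (a * c' - a' * c) 0.
  have [l [l_neq0 -> ->]] := colinear2 v_neq0 w_neq0 d0.
  rewrite -transvZ transvM; have [e0|e_neq0] := eqVneq (e1 + e2 * l ^+ 2) 0.
    rewrite e0 transv0; apply: Or33; split=> //.
    apply/sqcosetP; rewrite ?oppr_eq0 //; exists l^-1; rewrite ?invr_eq0 //.
    have -> : - e1 = e2 * l ^+ 2 by rewrite -[RHS](addKr e1) e0 addr0.
    by field.
  by apply/Or31/PSL2_unipotentP; exists (e1 + e2 * l ^+ 2), a, c.
set x := (transv e1 a c * _)%g.
have trx : \tr (SL2val x) = 2 - e1 * e2 * (a * c' - a' * c) ^+ 2.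
  exact: trace_transvM.
have trx2 : 2 - \tr (SL2val x) = e1 * e2 * (a * c' - a' * c) ^+ 2.
  by rewrite trx; ring.
have [trxN2|trx_neqN2] := eqVneq (\tr (SL2val x)) (-2); last first.
  apply/Or32/PhiP; exists x, (a * c' - a' * c); split=> //; last exact/eqP.
  apply/eqP; rewrite eq_sym -subr_eq0 trx2 !mulf_neq0 // expf_neq0 //.
apply/Or31; rewrite -toPSL2N.
have trNx : \tr (SL2val (SL2_opp x)) = 2 by rewrite raddfN /= trxN2 opprK.
apply/PSL2_unipotentP; suff Nx_neq1 : SL2_opp x <> 1%g.
  have [e [b [b' [e_neq0 b_neq0 ->]]]] := trace2_transv trNx Nx_neq1.
  by exists e, b, b'.
(* If [x] were [-1], the second factor would be [- transv (- e1) a c]; comparing traces gives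
   [2 = -2], against [2 != 0]. *)
move=> /(congr1 (@SL2val k)) /eqP.
rewrite -[SL2val (SL2_opp x)]/(- SL2val x) eqr_oppLR => /eqP xN1.
have : transv e2 a' c' = (transv (- e1) a c * x)%g.
  by rewrite mulgA -{2}[e1]opprK transvV mul1g.
move=> /(congr1 (fun y => \tr (SL2val y))); rewrite trace_transv.
have -> : SL2val (transv (- e1) a c * x)%g = - SL2val (transv (- e1) a c).
  by rewrite -[LHS]/(_ * SL2val x) xN1 mulrN1.
rewrite raddfN [- _]/(- \tr (SL2val (transv (- e1) a c))) trace_transv => /eqP.
rewrite -addr_eq0 (_ : 2 + 2 = 2 * 2); last by ring.
by rewrite mulf_eq0 orbb (negPf two_neq0).
Qed.

Lemma unip_class_mul1 (e1 e2 : k) : e1 != 0 -> e2 != 0 ->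
  sqcoset e2 = sqcoset (- e1) -> unip_class_mul e1 e2 1%g.
Proof.
move=> e1_neq0 e2_neq0 /sqcosetP[]; rewrite ?oppr_eq0 // => l l_neq0 e2E.
(* Since [e2 = - e1 * l ^+ 2], the second factor is [transv (- e1) l 0], the inverse of the
   first. *)
apply/unip_class_mulP; exists l, 0, 1, 0; rewrite l_neq0 oner_eq0; split=> //.
by rewrite e2E transvZ mulr1 mulr0 transvM subrr transv0.
Qed.

Lemma Phi_sub (e1 e2 : k) : u_le2 k -> e1 != 0 -> e2 != 0 ->
  Phi e1 e2 `<=` unip_class_mul e1 e2.
Proof.
move=> uk e1_neq0 e2_neq0 _ /PhiP[x [l [-> l_neq0 tr2 trN2 trx]]].
have [p [q [r [s [xE detx]]]]] := SL2_mx2P x.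
rewrite xE trace_mx2 in tr2 trN2 trx.
have disc_neq0 : (p - s) ^+ 2 - 4 * (- r * q) != 0.
  have -> : (p - s) ^+ 2 - 4 * (- r * q) = (p + s - 2) * (p + s + 2).
    transitivity ((p + s) ^+ 2 - 4 * (p * s - q * r)); first by ring.
    by rewrite detx; ring.
  by rewrite mulf_neq0 // ?subr_eq0 ?addr_eq0; apply/eqP.
have [a [c Qv]] := u_le2_binform_universal uk (e2 * l ^+ 2) disc_neq0.
exact: unip_class_mul_criterion xE trx Qv.
Qed.

Lemma unipotent_sub (e1 e2 : k) : u_le2 k ->
    (exists2 s : seq k, uniq s & (5 <= size s)%N) -> e1 != 0 -> e2 != 0 ->
  PSL2_unipotent k `<=` unip_class_mul e1 e2.
Proof.
move=> uk card_ge5 e1_neq0 e2_neq0 _ /PSL2_unipotentP[d [a [c [d_neq0 v_neq0 ->]]]].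
have [] := diag_binform_repr uk card_ge5 two_neq0 e1_neq0 e2_neq0 d_neq0.
  move=> [s [t [s_neq0 t_neq0 <-]]]; apply/unip_class_mulP.
  (* Along a common direction the coefficients add up. Being off the axes keeps both vectors
     nonzero, as membership in the two classes requires. *)
  exists (s * a), (s * c), (t * a), (t * c).
  rewrite -!transvZ transvM; split=> //;
    by rewrite !mulf_eq0 ?(negPf s_neq0) ?(negPf t_neq0).
move=> [x [r [x_neq0 r_neq0 xE rE]]]; rewrite -toPSL2N.
(* For [z = - transv d a c] the form of the criterion at [v'] is [- d det(v', v)^2]. The value
   [2 / r] turns [e1] times it into [4 = e1 * e2 * x ^+ 2], as the criterion demands with
   [l = x]. *)
have [a' [c' vw]] : exists a' c', a' * c - c' * a = 2 / r.
  case: (eqVneq c 0) => [c0|c_neq0].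
    exists 0, (- (2 / r / a)); rewrite c0 eqxx orbF in v_neq0 *.
    by field; rewrite v_neq0 r_neq0.
  by exists (2 / r / c), 0; field; rewrite c_neq0 r_neq0.
apply: (@unip_class_mul_criterion e1 e2 x _ _ _ _ _ a' c') => //=.
- by rewrite opp_mx2.
- by rewrite xE; ring.
apply: (mulfI e1_neq0).
transitivity (- d * e1 * (a' * c - c' * a) ^+ 2); first by rewrite /binform; ring.
by rewrite vw rE [RHS]mulrA xE; field.
Qed.

End SL2Theory.

Theorem theorem1p3 (k : fieldType)
    (uk : u_le2 k)
    (nqc : ~ quadratically_closed k)
    (char_neq2 : 2%N \notin [pchar k])
    (card_ge5 : exists2 s : seq k, uniq s & (5 <= size s)%N)
    (e1 e2 : k) (e1_neq0 : e1 != 0) (e2_neq0 : e2 != 0) :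
  let C1 := conj_class (toPSL2 (upper_unip e1)) in
  let C2 := conj_class (toPSL2 (upper_unip e2)) in
  (sqcoset e2 = sqcoset (- e1) ->
     set_mulg C1 C2 = PSL2_unipotent k `|` Phi e1 e2 `|` [set 1%g]) /\
  (sqcoset e2 <> sqcoset (- e1) ->
     set_mulg C1 C2 = PSL2_unipotent k `|` Phi e1 e2).
Proof.
move=> C1 C2; rewrite -[set_mulg C1 C2]/(unip_class_mul e1 e2).
have two_neq0 : 2 != 0 :> k by move: char_neq2; rewrite inE.
split=> coset; apply/seteqP; split=> g.
- by case/(unip_class_mul_sub two_neq0 e1_neq0 e2_neq0) => [|gP|[-> _]];
    [left; left | left; right | right].
- case=> [[]|->]; last exact: unip_class_mul1.
    exact: unipotent_sub.
  exact: Phi_sub.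
- by case/(unip_class_mul_sub two_neq0 e1_neq0 e2_neq0) => [|gP|[_ /coset]];
    [left | right | ].
- case; [exact: unipotent_sub | exact: Phi_sub].
Qed.
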